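(* For each $t\ge1$ let $x_t$ be an optimal solution of the distributionally robust problem $\min_{x\in\mathcal X}\max_{p\in\mathcal P_t}\mathbb E_{s\sim p}[f(x,s)]$. If the feasible set $\mathcal X$ is compact and $f(x,s)$ is continuous in $x$ (for each $s\in\mathcal S$), then almost surely any accumulation point of the sequence $\{x_t\}_{t=1}^\infty$ is an optimal solution of the stochastic optimization problem $\min_{x\in\mathcal X}\mathbb E_{s\sim p^*}[f(x,s)]$.
   Context: Scenarios: $\mathcal S=\{s_1,\dots,s_{|\mathcal S|}\}$ is a finite set, $\mathcal X\subseteq\mathbb R^d$ is the feasible set, $f:\mathcal X\times\mathcal S\to\mathbb R$, and $\mathcal P_0=\{p\in[0,1]^{|\mathcal S|}:\sum_k p_k=1\}$ is the probability simplex. For $p\in\mathcal P_0$, $\mathbb E_{s\sim p}[f(x,s)]=\sum_{k}f(x,s_k)p_k$. $p^*\in\mathcal P_0$ is the true distribution; i.i.d. scenarios are drawn from $p^*$, and $\hat p_t$ is the empirical distribution of the first $t$ observations. Ambiguity sets: fix $\delta\in(0,1)$ and $\delta_t=\frac{6\delta}{\pi^2t^2}$. For $t\ge1$, $\mathcal P_t$ is of one of the following types (the same type for all $t$): (1) confidence intervals: $\mathcal P_t=\{p\in\mathcal P_0: l_t\le p\le u_t\}$ with $l_{kt}=\hat p_{kt}-\frac{z_{\delta_t/2}}{2\sqrt t}$, $u_{kt}=\hat p_{kt}+\frac{z_{\delta_t/2}}{2\sqrt t}$, where $z_{\delta_t/2}$ is the $(1-\frac{\delta_t}{2})$-quantile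 of the standard normal distribution; (2) $\ell_2$-norm sets: $\mathcal P_t=\{p\in\mathcal P_0:\|p-\hat p_t\|_2\le\epsilon_t\}$ with $\epsilon_t=\sqrt{\frac{2|\mathcal S|\log(2/\delta_t)}{t}}$; (3) kernel based sets: $\mathcal P_t=\{p\in\mathcal P_0:\|p-\hat p_t\|_M\le\epsilon_t\}$ with $\epsilon_t=\frac{\sqrt C}{\sqrt t}\big(2+\sqrt{2\log(1/\delta_t)}\big)$, where $M=(k_M(s_i,s_j))_{i,j}$ is the (positive definite) matrix of a kernel $k_M:\mathcal S\times\mathcal S\to\mathbb R$ with $k_M(s_i,s_j)\le C$, and $\|q\|_M=\sqrt{q^\top Mq}$. Standing assumption: $\mathbb P(p^*\in\mathcal P_t)\ge1-\delta_t$ for every $t\ge1$. *)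

(* Defs.v *)
From HB Require Import structures.
From mathcomp Require Export all_boot all_order all_algebra finmap.
From mathcomp Require Export all_classical all_reals all_analysis.
Export Order.TTheory GRing.Theory Num.Theory.
Export numFieldNormedType.Exports.

Set Implicit Arguments.
Unset Strict Implicit.
Unset Printing Implicit Defensive.

Local Open Scope classical_set_scope.
Local Open Scope ring_scope.

(* The scenarios are s_k = enum_val k for k : 'I_#|S|; a vector indexed by
   them is a column of type 'cV[R]_#|S|. *)

Section Scenarios.
Context {R : realType} {S : finType}.
Implicit Types p q : 'cV[R]_#|S|.

Definition prob_simplex : set 'cV[R]_#|S| :=
  [set p | (forall k, 0 <= p k 0 <= 1) /\ \sum_k p k 0 = 1].

Definition expected_value (g : S -> R) p : R :=
  \sum_(k < #|S|) g (enum_val k) * p k 0.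

Definition l2_norm q : R := Num.sqrt (\sum_k q k 0 ^+ 2).

Definition gram_matrix (kM : S -> S -> R) : 'M[R]_#|S| :=
  \matrix_(i, j) kM (enum_val i) (enum_val j).

Definition matrix_norm (M : 'M[R]_#|S|) q : R := Num.sqrt ((q^T *m M *m q) 0 0).

Definition positive_definite (M : 'M[R]_#|S|) : Prop :=
  M^T = M /\ forall q, q != 0 -> 0 < (q^T *m M *m q) 0 0.

End Scenarios.

Section Quantile.
Context {R : realType}.

Definition quantile (mu : set R -> \bar R) (a : R) : R :=
  inf [set x : R | (a%:E <= mu [set` `]-oo, x]])%E].

Definition z_ (a : R) : R := quantile (normal_prob 0 1) (1 - a).

End Quantile.

Section AmbiguitySets.
Context {R : realType} {S : finType}.

Definition delta_ (delta : R) (t : nat) : R :=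
  6 * delta / (pi ^+ 2 * t%:R ^+ 2).

Inductive ambiguity_type : Type :=
| ConfidenceIntervals
| L2Ball
| KernelBall of (S -> S -> R) & R.

Definition admissible (T : ambiguity_type) : Prop :=
  match T with
  | KernelBall kM C =>
      positive_definite (gram_matrix kM) /\ forall s s', kM s s' <= C
  | _ => True
  end.

Definition ambiguity_set (T : ambiguity_type) (delta : R) (t : nat)
    (phat : 'cV[R]_#|S|) : set 'cV[R]_#|S| :=
  let dt := delta_ delta t in
  match T with
  | ConfidenceIntervals =>
      let r := z_ (dt / 2) / (2 * Num.sqrt t%:R) in
      [set p | prob_simplex p /\
               forall k, phat k 0 - r <= p k 0 <= phat k 0 + r]
  | L2Ball =>
      let eps := Num.sqrt (2 * #|S|%:R * ln (2 / dt) / t%:R) in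
      [set p | prob_simplex p /\ l2_norm (p - phat) <= eps]
  | KernelBall kM C =>
      let eps := Num.sqrt C / Num.sqrt t%:R *
                 (2 + Num.sqrt (2 * ln (dt^-1))) in
      [set p | prob_simplex p /\
               matrix_norm (gram_matrix kM) (p - phat) <= eps]
  end.

End AmbiguitySets.

Section Sampling.
Context {R : realType} {S : finType} {dO : measure_display}
  {Omega : measurableType dO}.

(* S carries its discrete sigma-algebra: as S is finite, measurability is
   tested on singletons and independence on arbitrary subsets of S. *)
Definition mutually_independent (P : probability Omega R)
    (xi : nat -> Omega -> S) : Prop :=
  forall (J : {fset nat}) (B : nat -> set S),
    P (\bigcap_(i in [set` J]) (xi i @^-1` B i)) =
    (\prod_(i <- J) P (xi i @^-1` B i))%E.

Definition iid_from (P : probability Omega R) (pstar : 'cV[R]_#|S|)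
    (xi : nat -> Omega -> S) : Prop :=
  [/\ forall i s, measurable (xi i @^-1` [set s]),
      forall i (k : 'I_#|S|), P (xi i @^-1` [set enum_val k]) = (pstar k 0)%:E
    & mutually_independent P xi].

(* The first t observations are xi 0, ..., xi (t - 1). *)
Definition empirical (xi : nat -> Omega -> S) (t : nat) (w : Omega) :
    'cV[R]_#|S| :=
  \col_(k < #|S|) (#|[set i : 'I_t | xi i w == enum_val k]%SET|%:R / t%:R).

End Sampling.

Section Optimization.
Context {R : realType} {S : finType} {d : nat}.

Definition optimal_solution (X : set 'rV[R]_d) (g : 'rV[R]_d -> R)
    (x : 'rV[R]_d) : Prop :=
  X x /\ forall y, X y -> g x <= g y.

(* The supremum is attained for compact nonempty Q: every ambiguity set with
   t >= 1 is compact and contains the empirical distribution. *)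
Definition worst_case (f : 'rV[R]_d -> S -> R) (Q : set 'cV[R]_#|S|)
    (x : 'rV[R]_d) : R :=
  sup [set expected_value (f x) p | p in Q].

End Optimization.

(* Main.v *)
Require Import Defs.
From mathcomp Require Import measurable_realfun ring lra.

(* The radius of every ambiguity set is of order [sqrt (log t / t)] or
   [log t / sqrt t], hence tends to 0: the normal quantile grows at most like
   the logarithm of the level, and on a finite-dimensional space the kernel norm
   dominates the coordinates. Since [\sum_t delta_t] converges, Borel-Cantelli
   puts [pstar] in almost all ambiguity sets, almost surely. As [f] is bounded on
   the compact [X], the worst-case objective then converges to the true
   objective uniformly on [X], so the [x_t] are asymptotically optimal for the
   true problem, and continuity passes this to accumulation points. *)

Set Implicit Arguments.
Unset Strict Implicit.
Unset Printing Implicit Defensive.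

Local Open Scope classical_set_scope.
Local Open Scope ring_scope.

(** * Tail and upper quantile of the standard normal law *)

(* Chernoff's bound at exponent 1: [e^x] times the density of [N(0, 1)] is
   [sqrt e] times the density of [N(1, 1)]. *)
Lemma normal_prob_tail (R : realType) (M : R) :
  (normal_prob 0 1 `]M, +oo[ <= (expR (2^-1 - M))%:E)%E.
Proof.
have pdf x : M <= x -> normal_pdf 0 1 x <= expR (2^-1 - M) * normal_pdf 1 1 x.
  move=> Mx; rewrite !normal_pdfE ?oner_eq0// mulrCA ler_wpM2l ?normal_peak_ge0//.
  by rewrite /normal_fun -expRD ler_expR expr1n subr0; lra.
have m1 : measurable_fun [set: R] (EFin \o normal_pdf (1 : R) 1).
  by apply/measurable_EFinP; exact: measurable_normal_pdf.
apply: (@le_trans _ _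
  (\int[lebesgue_measure]_x ((expR (2^-1 - M))%:E * (normal_pdf 1 1 x)%:E))%E).
  rewrite /normal_prob.
  apply: (@le_trans _ _ (\int[lebesgue_measure]_(x in `]M, +oo[)
     ((expR (2^-1 - M))%:E * (normal_pdf 1 1 x)%:E))%E).
    apply: ge0_le_integral => //=.
    - by move=> x _; rewrite lee_fin normal_pdf_ge0.
    - by apply/measurable_funTS/measurable_EFinP; exact: measurable_normal_pdf.
    - by apply/measurable_funTS; exact: measurable_funeM.
    - move=> x; rewrite in_itv/= andbT => /ltW Mx.
      by rewrite -EFinM lee_fin pdf.
  apply: ge0_subset_integral => //=.
  - exact: measurable_funeM.
  - by move=> x _; rewrite -EFinM lee_fin mulr_ge0 ?expR_ge0 ?normal_pdf_ge0.
rewrite ge0_integralZl//= ?integral_normal_pdf ?mule1 ?lee_fin ?expR_ge0//.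
by move=> x _; rewrite lee_fin normal_pdf_ge0.
Qed.

(* [inf] of a set that is not bounded below is [0], hence the assumption
   [0 <= M]. *)
Lemma inf_le_ge0 (R : realType) (A : set R) (M : R) : 0 <= M -> A M -> inf A <= M.
Proof.
move=> M0 AM; have [lbA|nlbA] := pselect (has_lbound A); first exact: ge_inf.
by rewrite inf_out// => -[].
Qed.

(** At [M = 1/2 + ln (1/a)] the Chernoff bound [expR (1/2 - M)] equals [a], so [M] lies in the set
    whose infimum is the quantile; [a <= 1] makes [M] nonnegative. *)
Lemma normal_upper_quantile_le (R : realType) (a : R) : 0 < a <= 1 ->
  z_ a <= 2^-1 + ln a^-1.
Proof.
move=> /andP[a0 a1]; apply: inf_le_ge0.
  by rewrite addr_ge0// ln_ge0// invf_ge1.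
rewrite /= -[X in normal_prob 0 1 X]setCK probability_setC; last exact: measurableC.
rewrite setCitvl EFinB leeB//.
apply: le_trans (normal_prob_tail _) _.
by rewrite lee_fin opprD addNKr lnV ?posrE// opprK lnK// posrE.
Qed.

(** * Kernel norms against coordinates *)

(* [q k 0] is the [M]-inner product of [q] with [invmx M *m delta_mx k 0], so
   Cauchy-Schwarz applies. *)
Lemma positive_definite_coord_le (R : realType) (S : finType) (M : 'M[R]_#|S|) :
  positive_definite M ->
  exists c : R, forall (q : 'cV[R]_#|S|) k, `|q k 0| <= c * matrix_norm M q.
Proof.
move=> [MT Mpos].
have Mge0 (q : 'cV[R]_#|S|) : 0 <= (q^T *m M *m q) 0 0.
  have [->|q0] := eqVneq q 0; last exact/ltW/Mpos.
  by rewrite mulmx0 mxE.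
have Msym (p q : 'cV[R]_#|S|) : p^T *m M *m q = (q^T *m M *m p)^T.
  by rewrite !trmx_mul trmxK MT mulmxA.
(* A nonzero row [r] with [r *m M = 0] would make the quadratic form vanish at [r^T]. *)
have Munit : M \in unitmx.
  rewrite -row_free_unit -kermx_eq0; apply/eqP/row_matrixP => i.
  apply/eqP; rewrite row0; apply/negPn/negP => ri0.
  have := Mpos (row i (kermx M))^T; rewrite trmx_eq0 trmxK => /(_ ri0).
  by rewrite -row_mul mulmx_ker row0 mul0mx mxE ltxx.
pose u (k : 'I_#|S|) : 'cV[R]_#|S| := invmx M *m delta_mx k 0.
have cs (q : 'cV[R]_#|S|) k : `|q k 0| <= matrix_norm M (u k) * matrix_norm M q.
  set A := ((u k)^T *m M *m u k) 0 0; set B := (q^T *m M *m q) 0 0.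
  have uM : (u k)^T *m M = delta_mx 0 k.
    by rewrite trmx_mul trmx_delta trmx_inv MT mulmxKV.
  have uMq : ((u k)^T *m M *m q) 0 0 = q k 0.
    by rewrite uM -rowE mxE.
  have qMu : (q^T *m M *m u k) 0 0 = q k 0.
    by rewrite Msym mxE.
  have quad s : 0 <= s ^+ 2 * A + 2 * s * q k 0 + B.
    have := Mge0 (s *: u k + q).
    have -> : (s *: u k + q)^T = s *: (u k)^T + q^T by rewrite linearP.
    rewrite !mulmxDl !mulmxDr -!scalemxAl -!scalemxAr.
    have E (N1 N2 N3 N4 : 'M[R]_1) :
        (s *: (s *: N1) + s *: N2 + (s *: N3 + N4)) 0 0 =
        s ^+ 2 * N1 0 0 + s * N2 0 0 + s * N3 0 0 + N4 0 0.
      by rewrite !mxE; ring.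
    rewrite E uMq qMu -/A -/B => h; apply: le_trans h _.
    by rewrite le_eqVlt; apply/orP; left; apply/eqP; ring.
  have A0 : 0 < A.
    apply: Mpos; apply/eqP => uk0; have : M *m u k = 0 by rewrite uk0 mulmx0.
    rewrite /u mulKVmx// => /matrixP/(_ k 0); rewrite !mxE !eqxx => /eqP.
    by rewrite oner_eq0.
  rewrite /matrix_norm -sqrtrM ?(ltW A0)// -/A -/B -sqrtr_sqr ler_wsqrtr//.
  (* The quadratic in [s] is minimal at [s = - q k 0 / A]; its value there, times [A], is
     [A * B - q k 0 ^+ 2]. *)
  have := mulr_ge0 (ltW A0) (quad (- q k 0 / A)).
  suff -> : A * ((- q k 0 / A) ^+ 2 * A + 2 * (- q k 0 / A) * q k 0 + B)
    = A * B - q k 0 ^+ 2 by rewrite subr_ge0.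
  by field; rewrite gt_eqF.
exists (\sum_k matrix_norm M (u k)) => q k.
apply: le_trans (cs q k) _; rewrite ler_wpM2r ?sqrtr_ge0//.
by rewrite (bigD1 k)//= lerDl sumr_ge0// => i _; exact: sqrtr_ge0.
Qed.

(** * Convergence of the radii to 0 *)

Lemma cvg_sqrt0 (R : realType) (u : R^nat) :
  u @ \oo --> 0 -> (fun t => Num.sqrt (u t)) @ \oo --> 0.
Proof.
move=> u0; rewrite -[in X in _ --> X](@sqrtr0 R).
exact: (cvg_comp _ _ u0 (@sqrt_continuous R 0)).
Qed.

Lemma cvg_invn (R : realType) : (fun t : nat => (t%:R : R)^-1) @ \oo --> 0.
Proof. by rewrite -cvg_shiftS; exact: cvg_harmonic. Qed.

Lemma cvg_mulr0 (R : realType) (c : R) (u : R^nat) :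
  u @ \oo --> 0 -> (fun t => c * u t) @ \oo --> 0.
Proof.
rewrite -[in X in _ -> X](mulr0 c) => u0.
by apply: cvgM => //; exact: cvg_cst.
Qed.

Lemma cvg_inv_sqrtn (R : realType) :
  (fun t : nat => (Num.sqrt (t%:R : R))^-1) @ \oo --> 0.
Proof.
under eq_fun do rewrite -sqrtrV ?ler0n//.
exact/cvg_sqrt0/cvg_invn.
Qed.

(** The argument of [ln] has this form because [1 / delta_t] is a constant times [t^2]; the radii of
    all three types reduce to this limit. *)
Lemma cvg_ln_over_sqrtn (R : realType) (c : R) : 0 < c ->
  (fun t : nat => ln (c * t%:R ^+ 2) / Num.sqrt t%:R) @ \oo --> 0.
Proof.
move=> c0.
(* With [r = t^(1/4)], [ln (c t^2) = ln c + 8 ln r] and [ln r < r]. *)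
pose r t : R := Num.sqrt (Num.sqrt t%:R).
have rV0 : (fun t => (`|ln c| + 8) * (r t)^-1) @ \oo --> 0.
  apply: cvg_mulr0.
  under eq_fun do rewrite /r -sqrtrV ?sqrtr_ge0//.
  exact/cvg_sqrt0/cvg_inv_sqrtn.
apply/norm_cvg0P; apply: (@squeeze_cvgr _ _ _ _ (cst 0) _ _ _ _ _ rV0).
  2: exact: cvg_cst.
near=> t; rewrite normr_ge0/=.
have t1 : (1 <= t%:R :> R) by rewrite ler1n; near: t; exact: nbhs_infty_ge.
have r1 : 1 <= r t.
  by rewrite -[leLHS]sqrtr1 ler_wsqrtr// -[leLHS]sqrtr1 ler_wsqrtr.
have r0 : 0 < r t by exact: lt_le_trans r1.
have rr : Num.sqrt t%:R = r t ^+ 2 :> R by rewrite sqr_sqrtr ?sqrtr_ge0.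
have rt : t%:R = r t ^+ 4 :> R.
  by rewrite (exprM _ 2 2) -rr sqr_sqrtr.
rewrite rr rt -exprM lnM ?posrE ?exprn_gt0// lnXn// normrM normfV.
rewrite (ger0_norm (exprn_ge0 2 (ltW r0))).
rewrite ler_pdivrMr ?exprn_gt0// expr2 !mulrA mulfVK ?gt_eqF//.
apply: (le_trans (ler_normD _ _)); rewrite mulrDl lerD//.
  by rewrite ler_peMr.
rewrite ger0_norm ?mulrn_wge0 ?ln_ge0// -[leLHS]mulr_natl.
by have := ln_sublinear r0; lra.
Unshelve. all: by end_near. Qed.

Lemma delta_gt0 (R : realType) (delta : R) (t : nat) :
  0 < delta -> (0 < t)%N -> 0 < delta_ delta t.
Proof.
by move=> d0 t0; rewrite divr_gt0 ?mulr_gt0 ?exprn_gt0 ?pi_gt0 ?ltr0n.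
Qed.

(** Since [delta < 1] and [pi >= 2], one has [6 * delta / pi ^+ 2 <= 2]. The bound gives summability
    and also makes [delta_t / 2] a level at most 1. *)
Lemma delta_le (R : realType) (delta : R) (t : nat) :
  0 < delta < 1 -> (0 < t)%N -> delta_ delta t <= 2 / t%:R ^+ 2.
Proof.
move=> /andP[d0 d1] t0; rewrite /delta_ invfM mulrA ler_wpM2r//.
rewrite ler_pdivrMr ?exprn_gt0 ?pi_gt0//.
have : 2 ^+ 2 <= pi ^+ 2 :> R by rewrite lerXn2r ?nnegrE ?pi_ge2 ?pi_ge0.
by lra.
Qed.

(** The only place where the three types are told apart. The radius [rho] does not depend on the
    sample, so later estimates are deterministic once [pstar] is in the set. *)
Lemma ambiguity_set_radius (R : realType) (S : finType)
    (T : @ambiguity_type R S) (delta : R) :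
  0 < delta < 1 -> admissible T ->
  exists2 rho : R^nat, rho @ \oo --> 0 &
    forall t phat p k, (0 < t)%N -> ambiguity_set T delta t phat p ->
      `|p k 0 - phat k 0| <= rho t.
Proof.
move=> d01; have /andP[d0 _] := d01.
pose g c t : R := ln (c * t%:R ^+ 2) / Num.sqrt t%:R.
pose v t : R := (Num.sqrt t%:R)^-1.
pose c1 : R := pi ^+ 2 / (6 * delta).
have c1_gt0 : 0 < c1 by rewrite divr_gt0 ?mulr_gt0 ?exprn_gt0 ?pi_gt0.
have c2_gt0 : 0 < 2 * c1 by rewrite mulr_gt0.
have dV t : (delta_ delta t)^-1 = c1 * t%:R ^+ 2.
  by rewrite /delta_ /c1 invf_div mulrAC.
have dV2 t : 2 / delta_ delta t = 2 * c1 * t%:R ^+ 2 by rewrite dV mulrA.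
have v0 : v @ \oo --> 0 by exact: cvg_inv_sqrtn.
have gv c t : ln (c * t%:R ^+ 2) / t%:R = g c t * v t.
  by rewrite /g /v -mulrA -invfM -expr2 sqr_sqrtr.
have gv0 c : 0 < c -> (fun t => g c t * v t) @ \oo --> 0.
  move=> c0; rewrite -(mul0r (0 : R)).
  by apply: cvgM => //; exact: cvg_ln_over_sqrtn.
case: T => [_|_|kM C [kMpos _]].
(* The quantile bound [1/2 + ln (2 * c1 * t^2)] multiplied by [v t / 2]. *)
- exists (fun t => (4^-1 * v t + 2^-1 * g (2 * c1) t)).
    rewrite -[in X in _ --> X](addr0 (0 : R)).
    by apply: cvgD; apply: cvg_mulr0 => //; exact: cvg_ln_over_sqrtn.
  move=> t phat p k t0 [_ /(_ k) pk]; rewrite ler_distlC.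
  set r := z_ _ / _ in pk; suff rle : r <= 4^-1 * v t + 2^-1 * g (2 * c1) t.
    by move: pk => /andP[? ?]; apply/andP; split; lra.
  have dt0 := delta_gt0 d0 t0.
  have t1 : 1 <= t%:R :> R by rewrite ler1n.
  have dt2 : 0 < delta_ delta t / 2 <= 1.
    rewrite divr_gt0//= ler_pdivrMr// mul1r (le_trans (delta_le d01 t0))//.
    by rewrite ler_pdivrMr ?exprn_gt0 ?(lt_le_trans _ t1)// ler_peMr// expr_ge1.
  have := normal_upper_quantile_le dt2; rewrite invf_div dV2 => zle.
  have vt0 : 0 <= v t by rewrite invr_ge0 sqrtr_ge0.
  have -> : r = z_ (delta_ delta t / 2) * (2^-1 * v t) by rewrite /r invfM.
  apply: le_trans (ler_wpM2r _ zle) _; first by rewrite mulr_ge0.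
  by rewrite /g -/(v t); lra.
- exists (fun t => Num.sqrt (2 * #|S|%:R * (g (2 * c1) t * v t))).
    apply: cvg_sqrt0; by apply: cvg_mulr0; exact: gv0.
  move=> t phat p k t0 [_]; rewrite dV2 -[_ / t%:R]mulrA gv; apply: le_trans.
  rewrite -sqrtr_sqr ler_wsqrtr// (bigD1 k)//= !mxE lerDl sumr_ge0// => i _.
  exact: sqr_ge0.
- have [c cP] := positive_definite_coord_le kMpos.
  (* The sign of [c] is unknown, hence the absolute value. *)
  exists (fun t => `|c| * (Num.sqrt C *
      (2 * v t + Num.sqrt (2 * (g c1 t * v t))))).
    apply: cvg_mulr0.
    apply: cvg_mulr0.
    rewrite -[in X in _ --> X](addr0 (0 : R)); apply: cvgD.
      by apply: cvg_mulr0.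
    apply: cvg_sqrt0; by apply: cvg_mulr0; exact: gv0.
  move=> t phat p k t0 [_ pt]; have := cP (p - phat) k; rewrite !mxE.
  move=> /le_trans; apply.
  apply: (@le_trans _ _ (`|c| * matrix_norm (gram_matrix kM) (p - phat))).
    by rewrite ler_wpM2r ?sqrtr_ge0// ler_norm.
  apply: ler_wpM2l => //; apply: le_trans pt _.
  rewrite dV -gv (mulrA 2) [_ / t%:R]mulrC [in leRHS]sqrtrM ?invr_ge0// sqrtrV//.
  by rewrite -/(v t) le_eqVlt; apply/orP; left; apply/eqP; ring.
Qed.

(** * Measurability of the events and Borel-Cantelli *)

Lemma measurable_sample_event (dO : measure_display)
    (Omega : measurableType dO) (S : finType) (xi : nat -> Omega -> S) (t : nat)
    (Q : set {ffun 'I_t -> S}) :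
  (forall i s, measurable (xi i @^-1` [set s])) ->
  measurable [set w | Q [ffun i : 'I_t => xi i w]].
Proof.
move=> mxi.
(* The sample takes finitely many values, so any event on it is a finite union of finite
   intersections of coordinate events. *)
have -> : [set w | Q [ffun i : 'I_t => xi i w]] =
    \bigcup_(v in Q) \bigcap_(i in [set: 'I_t]) (xi i @^-1` [set v i]).
  apply/seteqP; split=> [w Qw|w [v Qv vw]] /=.
    by exists [ffun i : 'I_t => xi i w] => // i _; rewrite /= ffunE.
  by have <- : v = [ffun i : 'I_t => xi i w]
    by apply/ffunP => i; rewrite ffunE -(vw i).
apply: fin_bigcup_measurable => [|v _]; first exact: finite_finset.
by apply: fin_bigcap_measurable => // i _; exact: mxi.
Qed.

Lemma measurable_empirical_event (R : realType) (dO : measure_display)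
    (Omega : measurableType dO) (S : finType) (xi : nat -> Omega -> S) (t : nat)
    (Q : set 'cV[R]_#|S|) :
  (forall i s, measurable (xi i @^-1` [set s])) ->
  measurable [set w | Q (empirical xi t w)].
Proof.
move=> mxi.
pose h (v : {ffun 'I_t -> S}) : 'cV[R]_#|S| :=
  \col_k (#|[set i | v i == enum_val k]%SET|%:R / t%:R).
have hE w : empirical xi t w = h [ffun i : 'I_t => xi i w].
  apply/matrixP => k l; rewrite !mxE; congr (_%:R / _).
  by apply: eq_card => i; rewrite !inE ffunE.
under eq_set do rewrite hE.
exact: (@measurable_sample_event _ _ _ _ _ (h @^-1` Q)).
Qed.

(** Comparison with a telescoping series: [1/m^2 <= 2 * (1/m - 1/(m+1))] for [m >= 1], so all
    partial sums are at most 2. *)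
Lemma nneseries_inv_sqr_lty (R : realType) :
  (\sum_(n <oo) ((n.+1%:R ^+ 2)^-1 : R)%:E < +oo)%E.
Proof.
have le2 n : (n.+1%:R ^+ 2)^-1 <= 2 * (n.+1%:R^-1 - n.+2%:R^-1) :> R.
  have n0 : 0 < n.+1%:R :> R by rewrite ltr0n.
  have n1 : 1 <= n.+1%:R :> R by rewrite ler1n.
  rewrite -(natr1 n.+1); move: n.+1%:R n0 n1 => m m0 m1.
  have m10 : 0 < m + 1 by rewrite addr_gt0.
  have -> : 2 * (m^-1 - (m + 1)^-1) = 2 / (m * (m + 1)).
    by field; rewrite !gt_eqF.
  rewrite -div1r ler_pdivlMr ?mulr_gt0// mulrAC ler_pdivrMr ?exprn_gt0//.
  by nra.
apply: (@le_lt_trans _ _ 2%:E); last exact: ltry.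
apply: lime_le; first by apply: is_cvg_nneseries => n _ _; rewrite lee_fin.
apply: nearW => n; rewrite sumEFin lee_fin.
apply: (@le_trans _ _ (\sum_(0 <= i < n) 2 * (i.+1%:R^-1 - i.+2%:R^-1))).
  by apply: ler_sum => i _; exact: le2.
rewrite -mulr_sumr -[leRHS]mulr1 ler_wpM2l//.
under eq_bigr do rewrite -opprB.
by rewrite sumrN telescope_sumr// opprB invr1 gerBl.
Qed.

Lemma borel_cantelli_eventually (R : realType) (dO : measure_display)
    (Omega : measurableType dO) (P : probability Omega R) (E : (set Omega)^nat)
    (a : R^nat) :
  (forall n, measurable (E n)) -> (forall n, ((1 - a n)%:E <= P (E n))%E) ->
  (\sum_(n <oo) (a n)%:E < +oo)%E ->
  {ae P, forall w, \forall n \near \oo, E n w}.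
Proof.
move=> mE PE a_fin.
have mCE n : measurable (~` E n) by exact: measurableC.
have PCE n : (P (~` E n) <= (a n)%:E)%E.
  rewrite probability_setC//; have := PE n.
  rewrite -(fineK (fin_num_measure P _ (mE n))) -EFinB !lee_fin; lra.
have sup0 : P (lim_sup_set (fun n => ~` E n)) = 0%E.
  apply: lim_sup_set_cvg0 => //; apply: le_lt_trans a_fin.
  by apply: lee_nneseries => n *; [exact: measure_ge0|exact: PCE].
exists (lim_sup_set (fun n => ~` E n)); split => //.
  by apply: bigcapT_measurable => n; apply: bigcup_measurable => k _.
move=> w nEw n _; apply: contrapT => nEn; apply: nEw.
exists n => // m nm; apply: contrapT => Emw; apply: nEn.
by exists m.
Qed.

(** * Near-optimal sequences and bounds on the worst case *)

Lemma cluster_near_optimal (R : realType) (d : nat) (X : set 'rV[R]_d)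
    (g : 'rV[R]_d -> R) (x : nat -> 'rV[R]_d) (e : R^nat) (a : 'rV[R]_d) :
  closed X -> {within X, continuous g} -> e @ \oo --> 0 ->
  (\forall t \near \oo, X (x t) /\ forall y, X y -> g (x t) <= g y + e t) ->
  cluster (x @ \oo) a -> optimal_solution X g a.
Proof.
move=> clX cg e0 xopt xa.
have Xa : X a.
  apply: clX => B Ba; apply: (xa X B) => //.
  by apply: filterS xopt => t [].
split=> // y Xy; apply/ler_addgt0Pr => eps eps0.
have eps20 : 0 < eps / 2 by rewrite divr_gt0.
move/subspace_continuousP/(_ a Xa)/cvgrPdist_lt/(_ _ eps20) : cg => ga.
(* A cluster point gives [z] both near-optimal and close to [a]: half of [eps] pays for
   near-optimality, half for continuity. *)
have [|z [[Xz gz]]] := xa [set z | X z /\ g z <= g y + eps / 2] _ _ ga.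
  have e0' : \forall t \near \oo, e t < eps / 2 by exact: cvgr_lt e0 _ eps20.
  apply: filterS2 xopt e0' => t [Xxt /(_ _ Xy) gxt] et; split=> //.
  by apply: le_trans gxt _; rewrite lerD2l ltW.
by move=> /(_ Xz); rewrite ltr_distlC /from_subspace => /andP[+ _]; lra.
Qed.

Lemma expected_value_dist (R : realType) (S : finType) (g : S -> R)
    (K r : R) (p q : 'cV[R]_#|S|) :
  (forall s, `|g s| <= K) -> (forall k, `|p k 0 - q k 0| <= r) ->
  `|expected_value g p - expected_value g q| <= #|S|%:R * (K * r).
Proof.
move=> gK pq; rewrite /expected_value -sumrB.
apply: le_trans (ler_norm_sum _ _ _) _.
rewrite mulr_natl -[X in _ *+ X]card_ord -sumr_const; apply: ler_sum => k _.
by rewrite -mulrBr normrM ler_pM.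
Qed.

(** The lower bound holds as [q] itself competes in the supremum; the upper one, as every competitor
    is [r]-close to [q]. The latter also bounds the set, so [sup] is not its default value. *)
Lemma worst_case_bounds (R : realType) (S : finType) (d : nat)
    (f : 'rV[R]_d -> S -> R) (Q : set 'cV[R]_#|S|) (q : 'cV[R]_#|S|)
    (y : 'rV[R]_d) (K r : R) :
  (forall s, `|f y s| <= K) -> Q q ->
  (forall p, Q p -> forall k, `|p k 0 - q k 0| <= r) ->
  expected_value (f y) q <= worst_case f Q y <=
    expected_value (f y) q + #|S|%:R * (K * r).
Proof.
move=> fK Qq Qr.
have ub : ubound [set expected_value (f y) p | p in Q]
    (expected_value (f y) q + #|S|%:R * (K * r)).
  move=> _ [p Qp <-]; rewrite -lerBlDl.
  by apply: le_trans (ler_norm _) _; apply: expected_value_dist => //; exact: Qr.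
apply/andP; split; last by apply: ge_sup => //; exists (expected_value (f y) q), q.
apply: ub_le_sup; last by exists q.
by exists (expected_value (f y) q + #|S|%:R * (K * r)).
Qed.

Lemma compact_uniform_bound (R : realType) (S : finType) (d : nat)
    (X : set 'rV[R]_d) (f : 'rV[R]_d -> S -> R) :
  compact X -> (forall s, {within X, continuous (f^~ s)}) ->
  exists K : R, forall y s, X y -> `|f y s| <= K.
Proof.
move=> cX cf.
have /choice[K KP] s : exists K : R, forall y, X y -> `|f y s| <= K.
  have /compact_bounded[M [_ MP]] := continuous_compact (cf s) cX.
  exists (M + 1) => y Xy; apply: (MP (M + 1)); first by rewrite ltrDl.
  by exists y.
exists (\sum_s `|K s|) => y s Xy; apply: le_trans (KP s y Xy) _.
by rewrite (bigD1 s)//= (le_trans (ler_norm _))// lerDl sumr_ge0.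
Qed.

Lemma within_continuous_expected_value (R : realType) (S : finType) (d : nat)
    (X : set 'rV[R]_d) (f : 'rV[R]_d -> S -> R) (p : 'cV[R]_#|S|) :
  (forall s, {within X, continuous (f^~ s)}) ->
  {within X, continuous (fun y => expected_value (f y) p)}.
Proof.
move=> cf; apply: continuous_big => [|k _].
  exact: add_continuous.
by move=> y; apply: cvgM; [exact: cf|exact: cvg_cst].
Qed.

Theorem theorem2p3 (R : realType) (S : finType) (d : nat)
    (X : set 'rV[R]_d) (f : 'rV[R]_d -> S -> R)
    (dO : measure_display) (Omega : measurableType dO)
    (P : probability Omega R)
    (pstar : 'cV[R]_#|S|) (xi : nat -> Omega -> S)
    (T : @ambiguity_type R S) (delta : R)
    (x : nat -> Omega -> 'rV[R]_d) :
  prob_simplex pstar ->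
  iid_from P pstar xi ->
  0 < delta < 1 ->
  admissible T ->
  (forall t : nat, (1 <= t)%N ->
    ((1 - delta_ delta t)%:E <=
     P [set w | ambiguity_set T delta t (empirical xi t w) pstar])%E) ->
  (forall (t : nat) (w : Omega), (1 <= t)%N ->
    optimal_solution X
      (worst_case f (ambiguity_set T delta t (empirical xi t w))) (x t w)) ->
  compact X ->
  (forall s : S, {within X, continuous (fun y => f y s)}) ->
  {ae P, forall w, forall a : 'rV[R]_d,
    cluster ((fun t => x t w) @ \oo) a ->
    optimal_solution X (fun y => expected_value (f y) pstar) a}.
Proof.
move=> _ [mxi _ _] d01 admT confT xopt cX cf.
have /andP[d0 _] := d01.
have [rho rho0 rhoP] := ambiguity_set_radius d01 admT.
have [K KP] := compact_uniform_bound cX cf.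
pose Q t w := ambiguity_set T delta t (empirical xi t w).
(* Indices are shifted because the confidence assumption starts at [t = 1]. *)
have evQ : {ae P, forall w, \forall n \near \oo, Q n.+1 w pstar}.
  apply: (@borel_cantelli_eventually _ _ _ _
    (fun n => [set w | Q n.+1 w pstar]) (fun n => delta_ delta n.+1)).
  - by move=> n; exact: (@measurable_empirical_event _ _ _ _ _ _
      (fun phat => ambiguity_set T delta n.+1 phat pstar) mxi).
  - by move=> n; exact: confT.
  - apply: (@le_lt_trans _ _
      (\sum_(n <oo) (2%:E * ((n.+1%:R ^+ 2)^-1 : R)%:E))%E).
      apply: lee_nneseries => n *; last by rewrite -EFinM lee_fin delta_le.
      by rewrite lee_fin ltW// delta_gt0.
    rewrite nneseriesZl//.
    by apply: lte_mul_pinfty => //; exact: nneseries_inv_sqr_lty.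
apply: filterS evQ => w evQ a.
have clX : closed X by exact: compact_closed.
(* The factor 2 is the triangle inequality through the empirical distribution: [pstar] and any other
   point of the set are each within [rho t] of it. *)
apply: (cluster_near_optimal (e := fun t => #|S|%:R * (K * (2 * rho t)))) => //.
- exact: within_continuous_expected_value.
- by do 3 apply: cvg_mulr0.
have {}evQ : \forall t \near \oo, Q t w pstar.
  have [N _ NP] := evQ; exists N.+1 => // -[//|n] Nn; exact: NP.
near=> t.
have t0 : (0 < t)%N by near: t; exact: nbhs_infty_gt.
have Qt : Q t w pstar by near: t.
have wc y : X y -> expected_value (f y) pstar <= worst_case f (Q t w) y <=
    expected_value (f y) pstar + #|S|%:R * (K * (2 * rho t)).
  move=> Xy; apply: worst_case_bounds => // [s|p Qp k]; first exact: KP.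
  have := rhoP _ _ _ k t0 Qp; have := rhoP _ _ _ k t0 Qt.
  by rewrite !ler_distl => /andP[? ?] /andP[? ?]; apply/andP; split; lra.
have [Xxt xmin] := xopt t w t0; split=> // y Xy.
have /andP[le1 _] := wc _ Xxt; have /andP[_ le2] := wc _ Xy.
(* True value at [x t w], then worst case there, then worst case at [y], then true value at [y] plus
   the error. *)
by apply: le_trans le1 _; apply: le_trans le2; exact: xmin.
Unshelve. all: by end_near. Qed.
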